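(* Let $\mathbb F$ be a division ring, $A\in\mathbb F^{n\times n}$ and $\mathbf v\in\mathbb F^{n\times1}$. The input pair $(A,\mathbf v)$ is controllable if and only if for every $\mathbf b\in\mathbb F^{n\times1}$ there is a polynomial $f\in\mathbb F[z]$ such that $$(\mathbf vf)^{\mathfrak e_\ell}(A)=\mathbf b.$$ In this case, for each $\mathbf b\in\mathbb F^{n\times 1}$, all polynomials $f\in\mathbb F[z]$ satisfying this condition are parametrized by the formula $$f=f_\ell+\mathfrak P_{A,\mathbf v}h,\qquad f_\ell(z)=\mathfrak A_n(z)\,\mathfrak C_{A,\mathbf v}^{-1}\mathbf b,\qquad h\in\mathbb F[z],$$ where $h$ is a free parameter and $f_\ell$ is the low-degree solution (the solution of degree less than $n$).
   Context: $\mathbb F[z]$ is the ring of polynomials over $\mathbb F$ in a formal variable $z$ commuting with the coefficients. For $f(z)=\sum_jf_jz^j$, $(\mathbf vf)^{\mathfrak e_\ell}(A)=\sum_jA^j\mathbf vf_j$. $\mathfrak P_{A,\mathbf v}$ is the monic generator of the right ideal $\{p\in\mathbb F[z]:(\mathbf vp)^{\mathfrak e_\ell}(A)=0\}$. $\mathfrak A_n(z)=[1\ z\ \cdots\ z^{n-1}]$, $\mathfrak C_{A,\mathbf v}=[\mathbf v\ A\mathbf v\ \cdots\ A^{n-1}\mathbf v]$, and $(A,\mathbf v)$ is controllable if $\mathfrak C_{A,\mathbf v}$ is invertible. *)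

(* Defs.v *)
From HB Require Import structures.
From mathcomp Require Import all_boot all_order all_algebra.
From mathcomp Require Import boolp classical_sets.

Set Implicit Arguments.
Unset Strict Implicit.
Unset Printing Implicit Defensive.

Import GRing.Theory.
Local Open Scope ring_scope.

(* [GRing.unit] means two-sided invertible and a [unitRingType] has 1 != 0, so
   this is exactly the notion of a (possibly noncommutative) division ring. *)
Definition division_ring (F : unitRingType) : Prop :=
  forall x : F, x != 0 -> x \is a GRing.unit.

(* [unitmx] and [invmx] require commutative coefficients, hence the following
   two definitions. *)
Definition is_inverse_mx (F : nzRingType) (n : nat) (M N : 'M[F]_n) : Prop :=
  M *m N = 1%:M /\ N *m M = 1%:M.

Definition invertible_mx (F : nzRingType) (n : nat) (M : 'M[F]_n) : Prop :=
  exists N : 'M[F]_n, is_inverse_mx M N.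

(* The inverse of M; the zero matrix if M is not invertible. *)
Definition inverse_mx (F : nzRingType) (n : nat) (M : 'M[F]_n) : 'M[F]_n :=
  xget 0 [set N | is_inverse_mx M N]%classic.

(* (v f)^{e_l}(A) = \sum_j A^j v f_j.  Scalars act on columns from the right,
   and right scaling of u : 'cV_n by c is u *m c%:M with c%:M : 'M_1;
   mathcomp's c *: u would multiply on the left. *)
Definition left_eval (F : nzRingType) (n : nat)
    (A : 'M[F]_n) (v : 'cV[F]_n) (f : {poly F}) : 'cV[F]_n :=
  \sum_(j < size f) A ^+ j *m v *m (f`_j)%:M.

Definition annihilator (F : nzRingType) (n : nat)
    (A : 'M[F]_n) (v : 'cV[F]_n) : set {poly F} :=
  [set p | left_eval A v p = 0]%classic.

(* P is monic and I = P F[z], the right ideal generated by P. *)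
Definition is_monic_right_generator (F : nzRingType)
    (I : set {poly F}) (P : {poly F}) : Prop :=
  P \is monic /\ I = [set P * h | h in [set: {poly F}]]%classic.

(* The monic generator of the annihilator of (A, v).  Over a division ring it
   exists, since A^0 v, ..., A^n v are right linearly dependent, and is unique;
   the default value 0 only serves to make the function total. *)
Definition min_poly (F : nzRingType) (n : nat)
    (A : 'M[F]_n) (v : 'cV[F]_n) : {poly F} :=
  xget 0 [set P | is_monic_right_generator (annihilator A v) P]%classic.

(* [1 z ... z^(n-1)] *)
Definition power_row (F : nzRingType) (n : nat) : 'rV[{poly F}]_n :=
  \row_(j < n) 'X^j.

(* [v Av ... A^(n-1)v] *)
Definition controllability_mx (F : nzRingType) (n : nat)
    (A : 'M[F]_n) (v : 'cV[F]_n) : 'M[F]_n :=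
  \matrix_(i < n, j < n) (A ^+ j *m v) i ord0.

Definition controllable (F : nzRingType) (n : nat)
    (A : 'M[F]_n) (v : 'cV[F]_n) : Prop :=
  invertible_mx (controllability_mx A v).

(* The entry of the 1 x 1 matrix [1 z ... z^(n-1)] C^-1 b. *)
Definition low_degree_solution (F : nzRingType) (n : nat)
    (A : 'M[F]_n) (v b : 'cV[F]_n) : {poly F} :=
  (power_row F n
     *m map_mx polyC (inverse_mx (controllability_mx A v) *m b)) ord0 ord0.

(* Main.v *)
(** Writing [C] for the controllability matrix, evaluation of a polynomial of
    degree less than [n] is [C] applied to its coefficient vector.  A nonzero
    annihilating polynomial of degree at most [n] always exists, so division by
    it reduces every value to one of such a polynomial: if evaluation is onto,
    [C] has a right inverse, which over a division ring is two-sided.  If [C] is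
    invertible, the annihilator contains a monic polynomial of degree [n] and no
    nonzero one of smaller degree, so division shows that it generates it. *)

Require Import Defs.
From mathcomp Require Import all_boot all_order all_algebra.
From mathcomp Require Import boolp classical_sets.

Set Implicit Arguments.
Unset Strict Implicit.
Unset Printing Implicit Defensive.

Import GRing.Theory.
Local Open Scope ring_scope.

(** * Left evaluation and the low-degree solution *)

Section LeftEval.

Variables (F : nzRingType) (n : nat) (A : 'M[F]_n).
Implicit Types (v b : 'cV[F]_n) (f h : {poly F}).

(** Padding with zero coefficients lets polynomials of different sizes be evaluated over a common
    index range. *)
Lemma left_evalE m v f : (size f <= m)%N ->
  left_eval A v f = \sum_(j < m) A ^+ j *m v *m (f`_j)%:M.
Proof.
move=> sf; rewrite /left_eval.
rewrite -(big_mkord xpredT (fun j => A ^+ j *m v *m (f`_j)%:M)).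
rewrite -(big_mkord xpredT (fun j => A ^+ j *m v *m (f`_j)%:M)).
rewrite [RHS](big_cat_nat (leq0n _) sf) /= [X in _ + X]big_nat_cond.
rewrite [X in _ + X]big1 ?addr0 // => j /andP[/andP[sj _] _].
by rewrite nth_default // raddf0 mulmx0.
Qed.

Lemma left_evalD v f h :
  left_eval A v (f + h) = left_eval A v f + left_eval A v h.
Proof.
pose m := maxn (size f) (size h).
rewrite (@left_evalE m _ (f + h)) ?size_polyD //.
rewrite (@left_evalE m _ f) ?leq_maxl // (@left_evalE m _ h) ?leq_maxr //.
rewrite -big_split; apply: eq_bigr => j _ /=.
by rewrite coefD raddfD mulmxDr.
Qed.

Lemma left_eval0 v : left_eval A v 0 = 0.
Proof. by rewrite /left_eval size_poly0 big_ord0. Qed.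

Lemma left_evalN v f : left_eval A v (- f) = - left_eval A v f.
Proof. by apply/eqP; rewrite -addr_eq0 -left_evalD addNr left_eval0. Qed.

Lemma left_eval0l f : left_eval A 0 f = 0.
Proof. by apply: big1 => j _; rewrite mulmx0 mul0mx. Qed.

Lemma left_evalC v c : left_eval A v c%:P = v *m c%:M.
Proof.
rewrite (@left_evalE 1) ?size_polyC ?leq_b1 // big_ord1 expr0.
by rewrite coefC mul1mx.
Qed.

Lemma left_evalMX v f : left_eval A v (f * 'X) = A *m left_eval A v f.
Proof.
rewrite (@left_evalE (size f).+1); last first.
  by rewrite (leq_trans (size_polyMleq _ _)) // size_polyX addn2.
rewrite big_ord_recl coefMX /= raddf0 mulmx0 add0r mulmx_sumr.
apply: eq_bigr => j _.
by rewrite coefMX /= exprS !mulmxA.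
Qed.

Lemma left_evalMC v f c : left_eval A v (f * c%:P) = left_eval A v f *m c%:M.
Proof.
rewrite (@left_evalE (size f)); last first.
  rewrite (leq_trans (size_polyMleq _ _)) // size_polyC.
  by case: (_ != 0); rewrite ?addn0 ?addn1 ?leq_pred.
rewrite mulmx_suml; apply: eq_bigr => j _.
apply/colP => i; rewrite coefMC !mxE !big_ord1 !mxE !big_ord1 !mxE.
by rewrite !eqxx !mulr1n mulrA.
Qed.

(** By induction on [h]: a right factor ['X] acts as [A] on the left, a right constant as right
    scaling. Hence the annihilator is a right ideal. *)
Lemma left_evalM v f h :
  left_eval A v (f * h) = left_eval A (left_eval A v f) h.
Proof.
elim/poly_ind: h => [|h c IH]; first by rewrite mulr0 !left_eval0.
by rewrite mulrDr mulrA !left_evalD !left_evalMX IH left_evalMC left_evalC.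
Qed.

Lemma left_eval_coef v f : (size f <= n)%N ->
  left_eval A v f = controllability_mx A v *m \col_(j < n) f`_j.
Proof.
move=> sf; rewrite (left_evalE _ sf); apply/colP => i.
rewrite summxE mxE; apply: eq_bigr => j _.
by rewrite !mxE big_ord1 !mxE eqxx mulr1n.
Qed.

Lemma low_degree_solutionE v b : low_degree_solution A v b =
  \sum_(j < n) 'X^j * ((inverse_mx (controllability_mx A v) *m b) j ord0)%:P.
Proof.
by rewrite /low_degree_solution mxE; apply: eq_bigr => j _; rewrite !mxE.
Qed.

Lemma size_low_degree_solution v b : (size (low_degree_solution A v b) <= n)%N.
Proof.
rewrite low_degree_solutionE; apply: (leq_trans (size_sum _ _ _)).
apply/bigmax_leqP => j _; rewrite (leq_trans (size_polyMleq _ _)) //.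
rewrite size_polyXn addSn /= size_polyC.
by apply: leq_trans (ltn_ord j); case: (_ != 0); rewrite ?addn0 ?addn1.
Qed.

Lemma col_low_degree_solution v b :
  \col_(j < n) (low_degree_solution A v b)`_j =
    inverse_mx (controllability_mx A v) *m b.
Proof.
apply/colP => j; rewrite mxE low_degree_solutionE coef_sum (bigD1 j) //=.
rewrite coefMC coefXn eqxx mul1r big1 ?addr0 // => k /negbTE kj.
by rewrite coefMC coefXn eq_sym val_eqE kj mul0r.
Qed.

Lemma inverse_mxP (M : 'M[F]_n) :
  invertible_mx M -> is_inverse_mx M (inverse_mx M).
Proof. by move=> invM; apply: (xgetPex 0 invM). Qed.

Lemma left_eval_low_degree_solution v b : controllable A v ->
  left_eval A v (low_degree_solution A v b) = b.
Proof.
move=> /inverse_mxP[CK _]; rewrite left_eval_coef ?size_low_degree_solution //.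
by rewrite col_low_degree_solution mulmxA CK mul1mx.
Qed.

(** The left inverse of the controllability matrix recovers the coefficients of [f] from its
    value. *)
Lemma low_degree_solution_uniq v b f : controllable A v ->
  left_eval A v f = b -> (size f <= n)%N -> f = low_degree_solution A v b.
Proof.
move=> /inverse_mxP[_ KC] <- sf; apply/polyP => j.
have [nj|jn] := leqP n j.
  by rewrite !nth_default // (leq_trans _ nj) ?size_low_degree_solution.
have /colP/(_ (Ordinal jn)) := col_low_degree_solution v (left_eval A v f).
by rewrite left_eval_coef // mulmxA KC mul1mx !mxE.
Qed.

End LeftEval.

(** * Left division and the monic generator of the annihilator *)

(* [rdivp] does not apply: it gives [f = q * P + r]. *)
Lemma monic_left_division (F : nzRingType) (P f : {poly F}) : P \is monic ->
  exists q r, f = P * q + r /\ (size r < size P)%N.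
Proof.
move=> mP; have P_gt0 : (0 < size P)%N by rewrite size_poly_gt0 monic_neq0.
elim/poly_ind: f => [|f c [q [r [-> sr]]]].
  by exists 0, 0; rewrite mulr0 addr0 size_poly0.
(* [s] has degree at most that of [P], and [d] is its coefficient in that degree. As [P] is monic,
   subtracting [P * d%:P] cancels it. *)
pose s := r * 'X + c%:P; pose d := s`_(size P).-1.
exists (q * 'X + d%:P), (s - P * d%:P); split.
  by rewrite [s - _]addrC addrA mulrDr addrK mulrDl mulrA -addrA.
rewrite -[X in (_ < X)%N](prednK P_gt0) ltnS; apply/leq_sizeP => j.
rewrite leq_eqVlt => /predU1P[<-|ltj].
  by rewrite coefB coefMC (monicP mP : P`_(size P).-1 = 1) mul1r subrr.
rewrite prednK // in ltj.
rewrite coefB coefMC [P`_j]nth_default // mul0r subr0 nth_default //.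
apply: leq_trans ltj; rewrite size_MXaddC.
by case: ifP.
Qed.

Lemma min_polyP (F : nzRingType) (n : nat) (A : 'M[F]_n) (v : 'cV[F]_n) :
  controllable A v ->
  is_monic_right_generator (annihilator A v) (min_poly A v).
Proof.
(* [l] takes the same value as ['X^n] in degree less than [n], so ['X^n - l] is monic of degree [n]
   and annihilates. *)
move=> cAv; pose l := low_degree_solution A v (A ^+ n *m v).
have sl : (size (- l) < size ('X^n : {poly F}))%N.
  by rewrite size_polyN size_polyXn ltnS size_low_degree_solution.
have sP : size ('X^n - l) = n.+1 by rewrite size_polyDl // size_polyXn.
have mP : 'X^n - l \is monic by rewrite monicE lead_coefDl // lead_coefXn.
have evX m : left_eval A v 'X^m = A ^+ m *m v.
  elim: m => [|m IH]; last by rewrite exprSr left_evalMX IH exprS mulmxA.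
  by rewrite !expr0 left_evalC mul1mx mulmx1.
have evP : left_eval A v ('X^n - l) = 0.
  by rewrite left_evalD left_evalN evX left_eval_low_degree_solution // subrr.
(* [min_poly] is chosen among the monic generators, so exhibiting one suffices. *)
apply: (@xgetPex _ 0 [set P | is_monic_right_generator _ P]%classic).
exists ('X^n - l); split=> //.
rewrite predeqE => f; split=> [evf|[h _ <-]]; last first.
  by rewrite /annihilator /= left_evalM evP left_eval0l.
have [q [r [fE sr]]] := monic_left_division f mP.
exists q => //; rewrite fE; move: evf.
rewrite /annihilator /= fE left_evalD left_evalM evP left_eval0l add0r => evr.
rewrite sP ltnS in sr.
(* The remainder and [0] are both low-degree solutions for the zero column, hence equal. *)
have r0 : r = low_degree_solution A v 0 by apply: low_degree_solution_uniq.
rewrite r0 -(low_degree_solution_uniq (f := 0) cAv (left_eval0 A v)) ?addr0 //.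
by rewrite size_poly0.
Qed.

(** * One-sided inverses and kernels of matrices *)

Lemma mulmx_onto_right_inverse (F : nzRingType) (n : nat) (M : 'M[F]_n) :
  (forall b : 'cV[F]_n, exists x, M *m x = b) -> exists N, M *m N = 1%:M.
Proof.
move=> /choice[g gK]; exists (\matrix_(i, j) g (col j 1%:M) i ord0).
apply/matrixP => i j; have /colP/(_ i) := gK (col j 1%:M).
by rewrite !mxE => <-; apply: eq_bigr => k _; rewrite mxE.
Qed.

Section DivisionRing.

Variables (F : unitRingType) (hF : division_ring F).

(** Gaussian elimination: row operations multiply on the left, so they are compatible with unknowns
    on the right. If the first column is zero, the first basis vector is a solution. *)
Lemma exists_kernel_col m (M : 'M[F]_(m, m.+1)) :
  exists2 x : 'cV[F]_m.+1, x != 0 & M *m x = 0.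
Proof.
elim: m M => [|m IH] M.
  exists (const_mx 1); last by apply/colP => -[].
  by apply/eqP => /colP/(_ ord0); rewrite !mxE => /eqP; rewrite oner_eq0.
have [[i Mi0]|M0] := pselect (exists i, M i ord0 != 0); last first.
  exists (delta_mx ord0 ord0).
    by apply/eqP => /colP/(_ ord0); rewrite !mxE => /eqP; rewrite oner_eq0.
  rewrite -colE; apply/colP => i; rewrite !mxE.
  by apply: contrapT => /eqP Mi; apply: M0; exists i.
pose a := M i ord0.
(* This is the Schur complement of the pivot [a]. The first entry [- (a^-1 * s)] of [x] below is
   what the pivot row forces. *)
have [y y0 My] := IH (\matrix_(k, j)
  (M (lift i k) (lift ord0 j) - M (lift i k) ord0 * a^-1 * M i (lift ord0 j))).
pose s := \sum_j M i (lift ord0 j) * y j ord0.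
pose x : 'cV[F]_m.+2 :=
  \col_j if unlift ord0 j is Some j' then y j' ord0 else - (a^-1 * s).
have x0 : x ord0 ord0 = - (a^-1 * s) by rewrite mxE unlift_none.
have xS j : x (lift ord0 j) ord0 = y j ord0 by rewrite mxE liftK.
exists x.
  apply: contra_neq y0 => x_eq0; apply/colP => j.
  by rewrite -xS x_eq0 !mxE.
apply/colP => k; rewrite mxE big_ord_recl x0 mxE.
under eq_bigr do rewrite xS.
have [k' ->|->] := unliftP i k; last first.
  by rewrite mulrN mulrA mulrV ?mul1r ?addNr //; exact: hF.
move/colP/(_ k'): My; rewrite !mxE => My; rewrite -[RHS]My.
under [in RHS]eq_bigr do rewrite mxE mulrBl -!mulrA.
by rewrite sumrB -!mulr_sumr addrC mulrN.
Qed.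

(* [N] is injective, so a kernel vector of [row_mx b N] has a nonzero first
   entry, which gives a preimage of [b] under [N]. *)
Lemma right_inverse_invertible n (C N : 'M[F]_n) :
  C *m N = 1%:M -> invertible_mx C.
Proof.
move=> CN; have onto (b : 'cV[F]_n) : exists x, N *m x = b; last first.
  (* Here [N' = C *m N *m N' = C], so [N] is also a left inverse of [C]. *)
  have [N' NN'] := mulmx_onto_right_inverse onto.
  have := congr1 (mulmx C) NN'; rewrite mulmxA CN mul1mx mulmx1 => N'E.
  by exists N; split=> //; rewrite -[in RHS]NN' N'E.
have [x x0] := exists_kernel_col (row_mx b N : 'M_(n, n.+1)).
rewrite -[x](@vsubmxK _ 1 n) in x0 *; move: (usubmx _) (dsubmx _) x0 => c y.
rewrite (mx11_scalar c); move: (c ord0 ord0) => {}c cy_neq0.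
rewrite (@mul_row_col _ _ 1) => Ncy; have c0 : c != 0.
  apply: contra_neq cy_neq0 => c0; move: Ncy; rewrite c0 raddf0 mulmx0 add0r.
  move=> /(congr1 (mulmx C)); rewrite mulmxA CN mul1mx mulmx0 => ->.
  exact: (@col_mx0 _ 1 n 1).
(* This solves [b *m c%:M + N *m y = 0] for [b]. *)
exists (- y *m (c^-1)%:M).
rewrite mulmxA mulmxN -[- _]add0r -Ncy addrK -mulmxA.
have -> : c%:M *m (c^-1)%:M = 1%:M :> 'M_1.
  apply/matrixP => i j; rewrite !ord1 !mxE big_ord1 !mxE eqxx !mulr1n.
  by rewrite mulrV ?hF.
by rewrite mulmx1.
Qed.

(** * From surjectivity of evaluation to controllability *)

(** A right linear dependence among the [n.+1] columns [A ^+ j *m v] gives the coefficients.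
    Dividing on the right by the leading one keeps the value zero. *)
Lemma exists_monic_annihilator n (A : 'M[F]_n) (v : 'cV[F]_n) :
  exists P, [/\ P \is monic, (size P <= n.+1)%N & left_eval A v P = 0].
Proof.
have [x x0 Mx] :=
  exists_kernel_col (\matrix_(i < n, j < n.+1) (A ^+ j *m v) i ord0).
pose p := \poly_(j < n.+1) x (inord j) ord0.
have sp : (size p <= n.+1)%N by apply: size_poly.
have px (j : 'I_n.+1) : p`_j = x j ord0 by rewrite coef_poly ltn_ord inord_val.
have p0 : p != 0.
  apply: contra_neq x0 => p0; apply/colP => j.
  by rewrite -px p0 coef0 mxE.
have lp : lead_coef p \is a GRing.unit by rewrite hF // lead_coef_eq0.
have evp : left_eval A v p = 0.
  rewrite (left_evalE A v sp) -[RHS]Mx; apply/colP => i.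
  rewrite summxE mxE; apply: eq_bigr => j _.
  by rewrite px !mxE big_ord1 !mxE eqxx mulr1n.
have lpV : lead_coef p * lead_coef (lead_coef p)^-1%:P = 1.
  by rewrite lead_coefC mulrV.
exists (p * (lead_coef p)^-1%:P); split.
- by rewrite monicE lead_coef_proper_mul lpV ?oner_neq0.
- apply: leq_trans (size_polyMleq _ _) _; rewrite size_polyC.
  by apply: leq_trans sp; case: (_ != 0); rewrite ?addn0 ?addn1 ?leq_pred.
by rewrite left_evalMC evp mul0mx.
Qed.

Lemma left_eval_onto_controllable n (A : 'M[F]_n) (v : 'cV[F]_n) :
  (forall b : 'cV[F]_n, exists f, left_eval A v f = b) -> controllable A v.
Proof.
move=> onto; have [P [mP sP evP]] := exists_monic_annihilator A v.
have Conto (b : 'cV[F]_n) : exists x, controllability_mx A v *m x = b.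
  have [f <-] := onto b; have [q [r [-> sr]]] := monic_left_division f mP.
  exists (\col_(j < n) r`_j); rewrite -left_eval_coef; last first.
    by rewrite -ltnS (leq_trans sr).
  by rewrite left_evalD left_evalM evP left_eval0l add0r.
have [N CN] := mulmx_onto_right_inverse Conto.
exact: right_inverse_invertible CN.
Qed.

End DivisionRing.

Theorem theorem5p1 (F : unitRingType) (hF : division_ring F)
    (n : nat) (A : 'M[F]_n) (v : 'cV[F]_n) :
  (controllable A v <->
     forall b : 'cV[F]_n, exists f : {poly F}, left_eval A v f = b)
  /\
  (controllable A v ->
     forall b : 'cV[F]_n,
       (forall f : {poly F},
          left_eval A v f = b <->
          exists h : {poly F},
            f = low_degree_solution A v b + min_poly A v * h)
       /\
       (left_eval A v (low_degree_solution A v b) = b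
        /\ (size (low_degree_solution A v b) <= n)%N
        /\ forall f : {poly F},
             left_eval A v f = b -> (size f <= n)%N ->
             f = low_degree_solution A v b)).
Proof.
split=> [|cAv b].
  split=> [cAv b|]; last exact: left_eval_onto_controllable hF _ _ _.
  by exists (low_degree_solution A v b); exact: left_eval_low_degree_solution.
have evl := left_eval_low_degree_solution b cAv.
split=> [f|]; last first.
  split; [exact: evl | split; [exact: size_low_degree_solution|move=> f]].
  exact: low_degree_solution_uniq.
have [_ annE] := min_polyP cAv.
(* Two solutions differ by an annihilating polynomial, so the parametrization reduces to this
   description. *)
have annP p : left_eval A v p = 0 <-> exists h, p = min_poly A v * h.
  rewrite -[_ = 0]/(annihilator A v p) annE.
  by split=> [[h _ <-]|[h ->]]; exists h.
split=> [evf|[h ->]].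
  have [|h fE] := (annP (f - low_degree_solution A v b)).1.
    by rewrite left_evalD left_evalN evf evl subrr.
  by exists h; rewrite -fE addrC subrK.
by rewrite left_evalD evl (annP _).2 ?addr0 //; exists h.
Qed.
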